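(* Let $|\varphi\rangle\in(\mathbb{C}^d)^{\otimes NM}$ be a PEPS on the $N\times M$ square lattice with periodic boundary conditions (torus), $$|\varphi\rangle=\sum_{i_{(1,1)},\dots,i_{(N,M)}=1}^d\mathcal{C}\big[\{A^{(j,k)}_{i_{(j,k)}}\}_{(j,k)}\big]\,|i_{(1,1)}\cdots i_{(N,M)}\rangle,$$ with possibly site-dependent four-index tensors $A^{(j,k)}_i$ of bond dimension $D$, and suppose that $|\varphi\rangle$ is translational invariant, i.e. invariant under cyclic translations of the sites by rows and by columns. Then there exist a finite bond dimension $D'$ and site-independent four-index tensors $S_i$, $i=1,\dots,d$, of bond dimension $D'$ such that $$|\varphi\rangle=\sum_{i_{(1,1)},\dots,i_{(N,M)}=1}^d\mathcal{C}\big[\{S_{i_{(j,k)}}\}_{(j,k)}\big]\,|i_{(1,1)}\cdots i_{(N,M)}\rangle.$$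
   Context: Sites are labelled by $(j,k)$, $j\in\mathbb{Z}/N$ (row), $k\in\mathbb{Z}/M$ (column). Each tensor $A^{(j,k)}_i$ has complex entries $A^{(j,k)}_{i;u,d,l,r}$ with indices $u$ (up), $d$ (down), $l$ (left), $r$ (right), each ranging over $\{1,\dots,D\}$. $\mathcal{C}[\cdot]$ is the full contraction along the edges of the torus: the right index of site $(j,k)$ is identified with the left index of site $(j,k+1)$, the down index of $(j,k)$ is identified with the up index of $(j+1,k)$ (indices of sites modulo $N$ and $M$), and all indices are summed over. *)

(* Defs.v *)
From HB Require Import structures.
From mathcomp Require Import all_boot all_order all_algebra.
From mathcomp Require Import reals.
From mathcomp Require Export complex.

Set Implicit Arguments.
Unset Strict Implicit.
Unset Printing Implicit Defensive.

Import GRing.Theory.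
Local Open Scope ring_scope.

(* The torus Z/N x Z/M: a site is a pair (row, column).  The cyclic structure
   is given by ordS and ord_pred, which compute modulo N and M; this includes
   sizes N = 1 and M = 1, for which 'Z_N would be the wrong type. *)
Definition site (N M : nat) : finType := ('I_N * 'I_M)%type.

Definition site_down (N M : nat) (p : site N M) : site N M := (ordS p.1, p.2).
Definition site_right (N M : nat) (p : site N M) : site N M := (p.1, ordS p.2).
Definition site_up (N M : nat) (p : site N M) : site N M := (ord_pred p.1, p.2).
Definition site_left (N M : nat) (p : site N M) : site N M :=
  (p.1, ord_pred p.2).

Definition config (d N M : nat) : finType := {ffun site N M -> 'I_d}.

(* (K^d)^{\otimes NM}, as the space of coefficient families in the product
   basis. *)
Definition state (K : comNzRingType) (d N M : nat) : lmodType K :=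
  {ffun config d N M -> K^o}.

Definition ket (K : comNzRingType) (d N M : nat) (s : config d N M) :
    state K d N M :=
  [ffun t : config d N M => (t == s)%:R : K^o].

(* The arguments of a tensor are, in this order, its up, down, left and right
   indices. *)
Definition tensor4 (K : Type) (D : nat) : Type :=
  'I_D -> 'I_D -> 'I_D -> 'I_D -> K.

(* h p is the common value of the right index of p and of the left index of
   site_right p; v p is the common value of the down index of p and of the up
   index of site_down p. *)
Definition contraction (K : comNzRingType) (D N M : nat)
    (T : site N M -> tensor4 K D) : K :=
  \sum_(h : {ffun site N M -> 'I_D}) \sum_(v : {ffun site N M -> 'I_D})
    \prod_(p : site N M) T p (v (site_up p)) (v p) (h (site_left p)) (h p).

Definition peps (K : comNzRingType) (d D N M : nat)
    (A : site N M -> 'I_d -> tensor4 K D) : state K d N M :=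
  \sum_(s : config d N M) contraction (fun p => A p (s p)) *: ket K s.

Definition translate_rows (K : comNzRingType) (d N M : nat)
    (phi : state K d N M) : state K d N M :=
  [ffun s : config d N M => phi [ffun p => s (site_down p)]].

Definition translate_cols (K : comNzRingType) (d N M : nat)
    (phi : state K d N M) : state K d N M :=
  [ffun s : config d N M => phi [ffun p => s (site_right p)]].

(* Invariance under the two generators of the translation group. *)
Definition translation_invariant (K : comNzRingType) (d N M : nat)
    (phi : state K d N M) : Prop :=
  translate_rows phi = phi /\ translate_cols phi = phi.

(* Main.v *)
Require Import Defs.
From mathcomp Require Import all_boot all_order all_algebra.
From mathcomp Require Import reals complex.

(** Let every bond carry, besides its original index, a site label, and let the
    new tensor be [c A^(q)] when the labels on its four legs are those of the
    site [q], and zero otherwise.  The surviving labellings of the torus are the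
    maps commuting with the translations, i.e. the translations themselves, so
    the new network is the sum of [c^(NM)] times the translates of the original
    state, all equal to it.  It remains to choose [c] as an [NM]-th root of the
    inverse of the number of these labellings. *)

Set Implicit Arguments.
Unset Strict Implicit.
Unset Printing Implicit Defensive.

Import GRing.Theory Num.Theory.
Local Open Scope ring_scope.

(** * Translations of the torus and the maps that commute with them *)

Section Torus.

Variables N M : nat.
Implicit Types p q : site N M.

Lemma site_downK : cancel (@site_down N M) (@site_up N M).
Proof. by case=> i j; rewrite /site_up /= ordSK. Qed.

Lemma site_upK : cancel (@site_up N M) (@site_down N M).
Proof. by case=> i j; rewrite /site_down /= ord_predK. Qed.

Lemma site_rightK : cancel (@site_right N M) (@site_left N M).
Proof. by case=> i j; rewrite /site_left /= ordSK. Qed.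

Lemma site_leftK : cancel (@site_left N M) (@site_right N M).
Proof. by case=> i j; rewrite /site_right /= ord_predK. Qed.

Lemma iter_ordS_val n a (i : 'I_n) : iter a (@ordS n) i = ((i + a) %% n)%N :> nat.
Proof.
elim: a => [|a IHa] /=; first by rewrite addn0 modn_small.
by rewrite IHa -addn1 modnDml addn1 addnS.
Qed.

Lemma iter_ordS_trans n (i j : 'I_n) : exists a, iter a (@ordS n) i = j.
Proof.
(* [n - i] steps lead from [i] around to 0, and [j] more steps lead to [j]. *)
exists (n - i + j)%N; apply: val_inj.
by rewrite /= iter_ordS_val addnA subnKC ?modnDl ?modn_small // ltnW.
Qed.

Definition site_shift a b p : site N M :=
  (iter a (@ordS N) p.1, iter b (@ordS M) p.2).

Lemma site_shift0 p : site_shift 0 0 p = p.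
Proof. by case: p. Qed.

Lemma site_shift_trans p q : exists a b, site_shift a b p = q.
Proof.
have [a Ha] := iter_ordS_trans p.1 q.1; have [b Hb] := iter_ordS_trans p.2 q.2.
by exists a, b; rewrite /site_shift Ha Hb; case: q {Ha Hb}.
Qed.

Lemma site_shiftC a b a' b' p :
  site_shift a b (site_shift a' b' p) = site_shift a' b' (site_shift a b p).
Proof. by rewrite /site_shift /= -!iterD addnC [(b + b')%N]addnC. Qed.

Lemma site_shiftSl a b p :
  site_shift a.+1 b p = site_shift a b (site_down p).
Proof. by rewrite /site_shift /= -iterSr. Qed.

Lemma site_shiftSr a b p :
  site_shift a b.+1 p = site_shift a b (site_right p).
Proof. by rewrite /site_shift /= -iterSr. Qed.

Lemma equivariant_site_shift (f : site N M -> site N M) a b p :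
    (forall q, f (site_down q) = site_down (f q)) ->
    (forall q, f (site_right q) = site_right (f q)) ->
  f (site_shift a b p) = site_shift a b (f p).
Proof.
move=> fD fR; elim: a p => [|a IHa] p; last by rewrite !site_shiftSl IHa fD.
elim: b p => [|b IHb] p; last by rewrite !site_shiftSr IHb fR.
by rewrite !site_shift0.
Qed.

(** Shifts act transitively and commute, so [f] is determined by its value at one site [o]: the
    shift taking [o] to [f o] agrees with [f] everywhere. *)
Lemma equivariant_shift (f : site N M -> site N M) :
    (forall q, f (site_down q) = site_down (f q)) ->
    (forall q, f (site_right q) = site_right (f q)) ->
  exists a b, f =1 site_shift a b.
Proof.
move=> fD fR; have [o _|no_site] := pickP (@predT (site N M)); last first.
  (* On an empty torus any two amounts will do. *)
  by exists 0%N, 0%N => p; have := no_site p.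
have [a [b Hab]] := site_shift_trans o (f o).
exists a, b => p; have [a' [b' <-]] := site_shift_trans o p.
by rewrite equivariant_site_shift // -Hab site_shiftC.
Qed.

End Torus.

(** * Contractions under relabelling of the sites *)

Section Contraction.

Variables (K : comNzRingType) (D N M : nat).
Implicit Types T : site N M -> tensor4 K D.

Lemma eq_contraction T1 T2 : T1 =1 T2 -> contraction T1 = contraction T2.
Proof.
by move=> eqT; apply: eq_bigr => h _; apply: eq_bigr => v _;
   apply: eq_bigr => p _; rewrite eqT.
Qed.

(** A bijection of the sites that respects neighbours merely renames the bond variables and permutes
    the factors. *)
Lemma contraction_reindex (f g : site N M -> site N M) T :
    cancel f g -> cancel g f ->
    {morph f : p / site_up p} -> {morph f : p / site_left p} ->
  contraction (T \o f) = contraction T.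
Proof.
move=> fK gK fU fL.
have ffun_bij : {on predT, bijective
    (fun h : {ffun site N M -> 'I_D} => [ffun p => h (f p)])}.
  exists (fun h : {ffun site N M -> 'I_D} => [ffun p => h (g p)]) => h _;
    by apply/ffunP=> p; rewrite !ffunE ?fK ?gK.
rewrite /contraction (reindex _ ffun_bij); apply: eq_bigr => h _.
rewrite (reindex _ ffun_bij); apply: eq_bigr => v _.
rewrite [RHS](reindex f) /=; last by exists g => p _.
by apply: eq_bigr => p _; rewrite !ffunE fU fL.
Qed.

Lemma contraction_down T : contraction (T \o @site_down N M) = contraction T.
Proof.
apply: contraction_reindex (@site_downK N M) (@site_upK N M) _ _ => p //.
by rewrite site_downK site_upK.
Qed.

Lemma contraction_right T : contraction (T \o @site_right N M) = contraction T.
Proof.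
apply: contraction_reindex (@site_rightK N M) (@site_leftK N M) _ _ => p //.
by rewrite site_rightK site_leftK.
Qed.

End Contraction.

(** Once there is a site, its bonds have no value in ['I_0], so the sum is empty. *)
Lemma contraction_bond0 (K : comNzRingType) (N M : nat)
    (T : site N M -> tensor4 K 0) :
  (0 < N)%N -> (0 < M)%N -> contraction T = 0.
Proof.
by move=> N_gt0 M_gt0; apply: big1 => h; case: (h (Ordinal N_gt0, Ordinal M_gt0)).
Qed.

Lemma pepsE (K : comNzRingType) (d D N M : nat)
    (A : site N M -> 'I_d -> tensor4 K D) (s : config d N M) :
  peps A s = contraction (fun p => A p (s p)).
Proof.
rewrite /peps sum_ffunE (bigD1 s) //= !ffunE eqxx.
rewrite big1 => [|t neq_ts]; first by rewrite addr0 [_ *: _]mulr1.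
by rewrite !ffunE eq_sym (negPf neq_ts) scaler0.
Qed.

(** Shifting the tensors under a fixed configuration amounts to shifting the configuration backwards
    under fixed tensors, which invariance undoes one step at a time. *)
Lemma translation_invariant_contraction (K : comNzRingType) (d D N M : nat)
    (A : site N M -> 'I_d -> tensor4 K D) a b (s : config d N M) :
    translation_invariant (peps A) ->
  contraction (fun p => A (site_shift a b p) (s p)) = peps A s.
Proof.
case=> invR invC; elim: a s => [|a IHa] s; first elim: b s => [|b IHb] s.
- by rewrite pepsE; apply: eq_contraction => p; rewrite site_shift0.
(* Invariance at [t] equates the amplitudes of [s] and [t]; reindexing along [site_right] then turns
   the shift by [b] at [t] into the shift by [b.+1] at [s]. *)
- set t : config d N M := [ffun p => s (site_left p)].
  have <- : [ffun p => t (site_right p)] = s :> config d N M.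
    by apply/ffunP=> p; rewrite !ffunE site_rightK.
  have /ffunP/(_ t) := invC; rewrite ffunE => ->.
  rewrite -IHb -[RHS]contraction_right; apply: eq_contraction => p /=.
  by rewrite site_shiftSr ffunE.
- set t : config d N M := [ffun p => s (site_up p)].
  have <- : [ffun p => t (site_down p)] = s :> config d N M.
    by apply/ffunP=> p; rewrite !ffunE site_downK.
  have /ffunP/(_ t) := invR; rewrite ffunE => ->.
  rewrite -IHa -[RHS]contraction_down; apply: eq_contraction => p /=.
  by rewrite site_shiftSl ffunE.
Qed.

(** * The site-independent tensor with labelled bonds *)

Section Labelled.

Variables (K : comNzRingType) (d D N M : nat).
Variables (A : site N M -> 'I_d -> tensor4 K D) (c : K).

Local Notation bond := (site N M * 'I_D)%type.
Local Notation labelling := {ffun site N M -> site N M}.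
Local Notation indexing := {ffun site N M -> 'I_D}.

(* The site of a tensor is read off its right leg. *)
Definition labels_fit (u w l r : site N M) : bool :=
  [&& w == r, u == site_up r & l == site_left r].

(** A bond carries the label of the site whose right or down leg it is, so the up and left legs show
    the labels of the neighbours. [enum_val] decodes an ordinal index into a label and an original
    index. *)
Definition labelled_tensor (i : 'I_d) : tensor4 K #|{: bond}| :=
  fun u w l r =>
    let: (qu, u) := enum_val u in let: (qw, w) := enum_val w in
    let: (ql, l) := enum_val l in let: (qr, r) := enum_val r in
    if labels_fit qu qw ql qr then c * A qr i u w l r else 0.

Definition equivariant (L : labelling) : bool :=
  [forall p, (L (site_up p) == site_up (L p))
             && (L (site_left p) == site_left (L p))].

Lemma equivariantP (L : labelling) :
  equivariant L -> exists a b, L =1 site_shift a b.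
Proof.
move=> /forallP eqL; apply: equivariant_shift => q.
- have /andP[/eqP] := eqL (site_down q).
  by rewrite site_downK => -> _; rewrite site_upK.
- have /andP[_ /eqP] := eqL (site_right q).
  by rewrite site_rightK => ->; rewrite site_leftK.
Qed.

Lemma equivariant_id : equivariant [ffun p => p].
Proof. by apply/forallP => p; rewrite !ffunE !eqxx. Qed.

(** Reindexing by [pack] splits each sum over bond values into a sum over labels and a sum over
    original indices. *)
Let pack (x : labelling * indexing) : {ffun site N M -> 'I_#|{: bond}|} :=
  [ffun p => enum_rank (x.1 p, x.2 p)].

Let pack_bij : {on predT, bijective pack}.
Proof.
exists (fun h => ([ffun p => (enum_val (h p)).1], [ffun p => (enum_val (h p)).2])).
  by case=> L h _; congr pair; apply/ffunP=> p; rewrite !ffunE enum_rankK.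
by move=> h _; apply/ffunP=> p; rewrite !ffunE -surjective_pairing enum_valK.
Qed.

(** Here [L] labels the horizontal bonds and [L'] the vertical ones. Comparing the down and right
    legs at each site forces [L' = L]; the two remaining conditions are then equivariance. *)
Lemma fit_labellings (L L' : labelling) :
  [forall p, labels_fit (L' (site_up p)) (L' p) (L (site_left p)) (L p)]
  = (L' == L) && equivariant L.
Proof.
apply/forallP/andP=> [fit | [/eqP-> /forallP eqL] p]; last first.
  by rewrite /labels_fit eqxx eqL.
have eqL' : L' = L by apply/ffunP=> p; have /and3P[/eqP] := fit p.
by split; [apply/eqP | apply/forallP=> p; have /and3P[_] := fit p; rewrite eqL' => -> ->].
Qed.

Lemma contraction_labelled (s : config d N M) :
  contraction (fun p => labelled_tensor (s p)) =
  \sum_(L | equivariant L)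
     c ^+ (N * M) * contraction (fun p => A (L p) (s p)).
Proof.
rewrite /contraction (reindex _ pack_bij).
under eq_bigr => x _ do rewrite (reindex _ pack_bij).
rewrite -(pair_bigA _ (fun L h => \sum_y \prod_p labelled_tensor (s p)
  (pack y (site_up p)) (pack y p) (pack (L, h) (site_left p)) (pack (L, h) p))) /=.
rewrite [RHS]big_mkcond; apply: eq_bigr => L _.
under eq_bigr => h _ do rewrite -(pair_bigA _ (fun L' v => \prod_p labelled_tensor (s p)
  (pack (L', v) (site_up p)) (pack (L', v) p) (pack (L, h) (site_left p))
  (pack (L, h) p))) /=.
(* One misfitting site annihilates the product; otherwise each of the [N * M] sites contributes a
   factor [c]. *)
have prodE h L' v : \prod_p labelled_tensor (s p)
    (pack (L', v) (site_up p)) (pack (L', v) p) (pack (L, h) (site_left p))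
    (pack (L, h) p) =
  if (L' == L) && equivariant L then c ^+ (N * M) *
    \prod_p A (L p) (s p) (v (site_up p)) (v p) (h (site_left p)) (h p) else 0.
  rewrite -fit_labellings; case: ifPn => [/forallP fit | /forallPn[p /negPf fitF]].
    have -> : (N * M)%N = #|site N M| by rewrite card_prod !card_ord.
    rewrite -prodr_const -big_split; apply: eq_bigr => p _.
    by rewrite /labelled_tensor !ffunE !enum_rankK fit.
  by rewrite (bigD1 p) //= /labelled_tensor !ffunE !enum_rankK fitF mul0r.
under eq_bigr => h _ do under eq_bigr => L' _ do under eq_bigr => v _ do
  rewrite prodE.
case: ifP => eqL; last first.
  by apply: big1 => h _; apply: big1 => L' _; apply: big1 => v _; rewrite andbF.
rewrite mulr_sumr; apply: eq_bigr => h _; rewrite mulr_sumr.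
(* The sum over vertical labellings collapses to the term [L' = L]. *)
rewrite (bigD1 L) //= [X in _ + X]big1 ?addr0 => [|L' /negPf neqL]; last first.
  by apply: big1 => v _; rewrite neqL.
by apply: eq_bigr => v _; rewrite eqxx.
Qed.

End Labelled.

(** Such a field [K] has all roots and inverts every positive integer, which is what the choice of
    [c] requires. *)
Lemma translation_invariant_uniform_peps (K : numClosedFieldType)
    (d D N M : nat) (A : site N M -> 'I_d -> tensor4 K D) :
    (0 < N)%N -> (0 < M)%N -> translation_invariant (peps A) ->
  exists (D' : nat) (S : 'I_d -> tensor4 K D'),
    (0 < D')%N /\ peps A = peps (fun _ : site N M => S).
Proof.
move=> N_gt0 M_gt0 inv; case: (posnP D) A inv => [-> | D_gt0] A inv.
  (* For [D = 0] the state vanishes, and the zero tensor of bond dimension 1 represents it. *)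
  exists 1%N, (fun _ _ _ _ _ => 0); split=> //; apply/ffunP=> s.
  rewrite !pepsE contraction_bond0 //; symmetry.
  apply: big1 => h _; apply: big1 => v _.
  by rewrite (bigD1 (Ordinal N_gt0, Ordinal M_gt0)) //= mul0r.
pose E := #|@equivariant N M|.
pose c : K := (N * M).-root E%:R^-1.
exists #|{: site N M * 'I_D}|, (labelled_tensor A c).
split; first by rewrite !card_prod !card_ord !muln_gt0 N_gt0 M_gt0.
apply/ffunP=> s; rewrite [RHS]pepsE contraction_labelled.
have sumE L : equivariant L ->
    c ^+ (N * M) * contraction (fun p => A (L p) (s p)) = E%:R^-1 * peps A s.
  move=> /equivariantP[a [b eqL]]; rewrite rootCK ?muln_gt0 ?N_gt0 //.
  rewrite -(translation_invariant_contraction a b s inv); congr (_ * _).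
  by apply: eq_contraction => p; rewrite eqL.
rewrite (eq_bigr _ sumE) sumr_const -[#|_|]/E -mulrnAl -mulr_natr mulVf ?mul1r //.
(* The identity labelling is equivariant, so [E] is a positive integer and is invertible in [K]. *)
by rewrite pnatr_eq0 -lt0n; apply/card_gt0P; exists [ffun p => p]; apply: equivariant_id.
Qed.

Theorem mainTheorem6 (R : realType) (N M d D : nat)
    (hN : (0 < N)%N) (hM : (0 < M)%N)
    (phi : state R[i]%C d N M)
    (A : site N M -> 'I_d -> tensor4 R[i]%C D)
    (hphi : phi = peps A)
    (hinv : translation_invariant phi) :
  exists (D' : nat) (S : 'I_d -> tensor4 R[i]%C D'),
    (0 < D')%N /\ phi = peps (fun _ : site N M => S).
Proof. by subst phi; apply: translation_invariant_uniform_peps. Qed.
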